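(* Let $m\in\mathbb{N}$, let $\alpha_2,\dots,\alpha_m\in\mathbb{R}$ and let $\gamma_1,\gamma_2\in\mathbb{R}$ satisfy $\gamma_1+\gamma_2=0$. For $X=(x,y)\in\mathbb{R}^2$ put $$u_k(X)=x_k+\gamma_k\left[\alpha_2(x+y)^2+\alpha_3(x+y)^3+\cdots+\alpha_m(x+y)^m\right],\qquad k=1,2,$$ where $x_1=x$, $x_2=y$. Let $W$ and $w$ be homogeneous polynomials of degree $m+1$ in $x$ and $y$ with real coefficients, and define $\tilde f:\mathbb{R}^2\to\mathbb{R}^2$ by $$\tilde f(X)=(u_1(X)+W(X),\;u_2(X)+w(X)).$$ If $\det D\tilde f(X)\equiv 1$, then there exist a linear homogeneous nondegenerate mapping $A:\mathbb{R}^2\to\mathbb{R}^2$ and a real constant $\alpha_{m+1}$ such that $\tilde f=A^{-1}\circ F\circ A$, where $$F(X)=\bigl(u_1(X)+\alpha_{m+1}(x+y)^{m+1},\;u_2(X)-\alpha_{m+1}(x+y)^{m+1}\bigr).$$ Moreover, the Jacobian conjecture is true for the mapping $\tilde f$, i.e. $\tilde f$ is invertible.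
   Context: $\mathbb{N}=\{1,2,3,\dots\}$; for $m=1$ the bracketed sum is empty (equal to $0$). $D\tilde f$ denotes the Jacobian matrix of $\tilde f$. A linear homogeneous nondegenerate mapping is an invertible linear map (no constant term). A polynomial map is called invertible if it has an inverse map which is also a polynomial map. The Jacobian conjecture asserts that every polynomial map whose Jacobian determinant is identically equal to a non-zero constant is invertible. *)

(* Defs.v *)
From mathcomp Require Import all_boot all_order all_algebra.
From mathcomp Require Import reals.
From mathcomp Require Import mpoly.

Set Implicit Arguments.
Unset Strict Implicit.
Unset Printing Implicit Defensive.

Import GRing.Theory.
Local Open Scope ring_scope.

Section PolynomialMaps.
Variables (R : comNzRingType) (n : nat).

(* A polynomial map R^n -> R^n is given by its n components. *)
Definition polymap := n.-tuple {mpoly R[n]}.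

Definition polymap_eval (f : polymap) (X : 'cV[R]_n) : 'cV[R]_n :=
  \col_i (tnth f i).@[fun j => X j 0].

Definition jacobian_mx (f : polymap) (X : 'cV[R]_n) : 'M[R]_n :=
  \matrix_(i, j) ((tnth f i)^`M(j)).@[fun k => X k 0].

Definition polymap_invertible (f : polymap) : Prop :=
  exists g : polymap,
    cancel (polymap_eval f) (polymap_eval g) /\
    cancel (polymap_eval g) (polymap_eval f).

End PolynomialMaps.

Section PlaneMaps.
Variable R : comNzRingType.

Definition varx : {mpoly R[2]} := 'X_ord0.
Definition vary : {mpoly R[2]} := 'X_ord_max.

(* Only alpha 2, ..., alpha m occur; the sum is empty for m = 1. *)
Definition alpha_sum (m : nat) (alpha : nat -> R) : {mpoly R[2]} :=
  \sum_(2 <= k < m.+1) alpha k *: (varx + vary) ^+ k.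

Definition u_map (m : nat) (alpha : nat -> R) (gamma1 gamma2 : R) :
  polymap R 2 :=
  [tuple varx + gamma1 *: alpha_sum m alpha;
         vary + gamma2 *: alpha_sum m alpha].

End PlaneMaps.

(* Main.v *)
Require Import Defs.
From mathcomp Require Import all_boot all_order all_algebra.
From mathcomp Require Import reals ring zify.
From mathcomp Require Import mpoly.

(** Write s = x + y, h = gamma1 (alpha_2 s^2 + ... + alpha_m s^m), q = h'(s),
    so that f = (x + h + W, y - h + w).  Expanding the determinant gives
    det Df = 1 + D + q T + J with
      D = W_x + w_y,   T = w_y - W_x - w_x + W_y,   J = W_x w_y - W_y w_x.
    A polynomial vanishing on all of R^2 is zero ([mpoly_meval_eq0]), so
    D + q T + J = 0 holds formally.  The summand D is homogeneous of degree m,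
    J of degree 2m, and q T has all its terms in degrees strictly between, since
    those of q lie in degrees 1, ..., m - 1; hence D = J = 0 and q T = 0
    ([degree_split]).

    D = J = 0 says that (W, w) is homogeneous of degree m + 1 with nilpotent
    Jacobian matrix.  By Euler's identity, J = 0 makes the logarithmic
    derivatives of W and w in x agree, and comparing leading monomials shows
    that W and w are proportional ([homog_proportional]):
    (W, w) = (a, b) V with (a, b) <> 0.  Then D = 0 says that V is constant in
    the direction (a, b), and Euler's identity again yields
    V = e L^(m+1) with L = b x - a y ([homog_constant_along]).

    There remain the two ways in which q T can vanish.
    - q = 0.  Then h = 0 and f = X + e L(X)^(m+1) (a, b).  A linear A with
      s o A = L sends (a, b), which lies in the kernel of L, to a multiple of
      (1, -1), so it conjugates f to the shear X + alpha s^(m+1) (1, -1).  Over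
      an ordered field a^2 + b^2 <> 0, which lets A be given by a formula with
      determinant a^2 + b^2.
    - T = 0.  As T is, up to a nonzero factor, e (a + b)^2 L^m, either
      e = 0, or L is a multiple of s and (a, b) one of (1, -1).  In both cases
      (W, w) = c s^(m+1) (1, -1), and A is the identity.

    In either case f moves every point X along a fixed vector v by a polynomial
    amount that is constant along v.  Such a shear is inverted by moving back
    ([shear_invertible]). *)

Set Implicit Arguments.
Unset Strict Implicit.
Unset Printing Implicit Defensive.

Import Order.TTheory GRing.Theory Num.Theory.
Local Open Scope ring_scope.

(** * Polynomials that vanish at every point *)

Lemma base_expansion_inj (B n : nat) (a b : 'I_n -> nat) :
  (forall i, (a i < B)%N) -> (forall i, (b i < B)%N) ->
  (\sum_i a i * B ^ i = \sum_i b i * B ^ i)%N -> a =1 b.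
Proof.
elim: n a b => [|n IHn] a b ltaB ltbB; first by move=> _ [].
have shift (c : 'I_n.+1 -> nat) :
    (\sum_i c i * B ^ i = (\sum_(i < n) c (lift ord0 i) * B ^ i) * B + c ord0)%N.
  rewrite big_ord_recl muln1 addnC big_distrl /=; congr addn.
  by apply: eq_bigr => i _; rewrite -mulnA -expnSr.
have B_gt0 : (0 < B)%N by apply: leq_ltn_trans (ltaB ord0).
rewrite !shift => eqab.
have eq0 : a ord0 = b ord0.
  by have := congr1 (modn^~ B) eqab; rewrite /= !modnMDl !modn_small.
have eqS : (a \o lift ord0) =1 (b \o lift ord0).
  apply: IHn => [i|i|]; [exact: ltaB | exact: ltbB |].
  by move/eqP: eqab; rewrite eq0 eqn_add2r eqn_pmul2r // => /eqP.
by move=> i; case: (unliftP ord0 i) => [j|] ->; [exact: eqS | exact: eq0].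
Qed.

Lemma poly_horner_eq0 (R : numDomainType) (p : {poly R}) :
  (forall t, p.[t] = 0) -> p = 0.
Proof.
move=> p0; pose rs := [seq (k%:R : R) | k <- iota 0 (size p)].
apply: (@roots_geq_poly_eq0 _ p rs); last by rewrite size_map size_iota.
  by apply/allP => t _; apply/rootP.
by rewrite map_inj_uniq ?iota_uniq // => j k /eqP; rewrite eqr_nat => /eqP.
Qed.

(** Kronecker substitution: replacing the i-th variable by t^(B^i) turns
    distinct monomials of p into distinct powers of t when B exceeds all the
    exponents, which reduces the claim to one variable. *)
Lemma mpoly_meval_eq0 (R : numDomainType) (n : nat) (p : {mpoly R[n]}) :
  (forall v : 'I_n -> R, p.@[v] = 0) -> p = 0.
Proof.
move=> p0; pose B := msize p.
pose e (k : 'X_{1..n}) := (\sum_(i < n) k i * B ^ i)%N.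
pose q := \sum_(k <- msupp p) p@_k *: 'X^(e k).
have q0 : q = 0.
  apply: poly_horner_eq0 => t; rewrite -(p0 (fun i => t ^+ (B ^ i))) mevalE.
  rewrite horner_sum; apply: eq_bigr => k _; rewrite hornerZ hornerXn.
  rewrite -prodrXr; congr (_ * _); apply: eq_bigr => i _.
  by rewrite mulnC exprM.
have digit_lt k i : k \in msupp p -> (k i < B)%N.
  move=> /msize_mdeg_lt; apply: leq_ltn_trans.
  by rewrite mdegE (bigD1 i) //= leq_addr.
apply/mpolyP => m; rewrite mcoeff0; apply/eqP/negPn; rewrite -mcoeff_msupp.
apply/negP => pm; have := congr1 (fun r : {poly R} => r`_(e m)) q0.
rewrite /= coef0 coef_sum (bigD1_seq m) ?msupp_uniq //= big_seq_cond big1.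
  by rewrite addr0 coefZ coefXn eqxx mulr1 => /eqP; rewrite mcoeff_eq0 pm.
move=> k /andP[pk nekm]; rewrite coefZ coefXn; case: eqP => [eqe|_].
  case/eqP: nekm; apply/mnmP/(base_expansion_inj _ _ (esym eqe)) => i;
  exact: digit_lt.
by rewrite mulr0.
Qed.

(** * Partial derivatives and Euler's identity *)

(** The operator x_i d/dx_i is diagonal on monomials; knowing its eigenvalues
    gives Euler's identity and controls leading monomials. *)
Lemma mcoeff_XMderiv (R : comNzRingType) (n : nat) (i : 'I_n)
    (p : {mpoly R[n]}) (m : 'X_{1..n}) :
  ('X_i * p^`M(i))@_m = (m i)%:R * p@_m.
Proof.
elim/mpolyind: p => [|c k p _ _ IHp].
  by rewrite raddf0 mulr0 mcoeff0 mulr0.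
rewrite mderivD mulrDr !mcoeffD mulrDr IHp; congr (_ + _).
rewrite mderivZ mderivX -!scalerAr -mpolyXD !mcoeffZ !mcoeffX.
case: (posnP (k i)) => [ki0|ki_gt0].
  by case: (k =P m) => [<-|_]; rewrite ?ki0 ?mulr0 ?mul0r ?mulr0.
have -> : (U_(i) + (k - U_(i)))%MM = k.
  rewrite addmC submK //; apply/mnm_lepP => j; rewrite mnm1E.
  by case: eqP => // <-.
by case: (k =P m) => [->|_]; rewrite ?mulr0 // mulrCA.
Qed.

Lemma mderiv_eq0_const (R : numDomainType) (n : nat) (p : {mpoly R[n]}) :
  (forall i, p^`M(i) = 0) -> p = (p@_0%MM)%:MP.
Proof.
move=> dp; apply/mpolyP => m; rewrite mcoeffC.
case: (m =P 0%MM) => [->|m0]; first by rewrite mulr1.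
case: (pickP (fun i => m i != 0%N)) => [i mi|m00].
  have := mcoeff_XMderiv i p m; rewrite dp mulr0 mcoeff0 => /eqP.
  by rewrite eq_sym mulf_eq0 pnatr_eq0 (negbTE mi) mulr0 => /eqP.
case: m0; apply/mnmP => i; rewrite mnm0E.
by move/negbFE/eqP: (m00 i).
Qed.

Lemma euler_homog (R : comNzRingType) (n d : nat) (p : {mpoly R[n]}) :
  p \is d.-homog -> \sum_i 'X_i * p^`M(i) = d%:R *: p.
Proof.
move=> hp; apply/mpolyP => m; rewrite raddf_sum /= mcoeffZ.
under eq_bigr do rewrite mcoeff_XMderiv.
rewrite -mulr_suml -natr_sum -mdegE.
have [->//|neq] := eqVneq (mdeg m) d.
by rewrite (dhomog_nemf_coeff hp neq) !mulr0.
Qed.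

Lemma dhomog_mderiv (R : comNzRingType) (n d : nat) (i : 'I_n)
    (p : {mpoly R[n]}) :
  p \is d.+1.-homog -> p^`M(i) \is d.-homog.
Proof.
move=> hp; apply/dhomogP => m; rewrite mcoeff_msupp mcoeff_deriv.
apply: contraNeq => neq; rewrite (@dhomog_nemf_coeff _ _ mdeg d.+1) ?mul0rn //.
by rewrite mfD /= mdeg1 addn1 eqSS.
Qed.

Lemma mderivXn (R : comNzRingType) (n k : nat) (i : 'I_n) (p : {mpoly R[n]}) :
  (p ^+ k.+1)^`M(i) = (p ^+ k * p^`M(i)) *+ k.+1.
Proof.
elim: k => [|k IHk]; first by rewrite expr1 expr0 mul1r.
by rewrite exprS mderivM IHk mulrnAr mulrA -exprS [_^`M(i) * _]mulrC -mulrS.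
Qed.

Lemma mderivXU (R : comNzRingType) (n : nat) (i j : 'I_n) :
  ('X_j : {mpoly R[n]})^`M(i) = (i == j)%:R.
Proof.
rewrite mderivX mnm1E eq_sym; case: eqP => [->|_]; last by rewrite scale0r.
have -> : (U_(j) - U_(j))%MM = 0%MM :> 'X_{1..n}.
  by apply/mnmP => k; rewrite mnmBE mnm0E subnn.
by rewrite scale1r mpolyX0.
Qed.

Lemma dhomog0_const (R : comNzRingType) (n : nat) (p : {mpoly R[n]}) :
  p \is 0.-homog -> p = (p@_0%MM)%:MP.
Proof.
move=> hp; apply/mpolyP => m; rewrite mcoeffC.
case: (m =P 0%MM) => [->|/eqP m0]; first by rewrite mulr1.
by rewrite (dhomog_nemf_coeff hp) ?mulr0 // mdeg_eq0.
Qed.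

(** * Two variables *)

Lemma forall_ord2 (P : 'I_2 -> Prop) : P ord0 -> P ord_max -> forall i, P i.
Proof.
move=> P0 P1 i; case: (unliftP ord0 i) => [j|] -> //.
by rewrite (_ : lift _ _ = ord_max) //; apply: val_inj; rewrite [j]ord1.
Qed.

Lemma sum_ord2 (V : nmodType) (F : 'I_2 -> V) : \sum_i F i = F ord0 + F ord_max.
Proof.
rewrite !big_ord_recl big_ord0 addr0.
by have -> : lift ord0 ord0 = ord_max :> 'I_2 by apply: val_inj.
Qed.

Lemma det_ord2 (R : comNzRingType) (M : 'M[R]_2) :
  \det M = M ord0 ord0 * M ord_max ord_max - M ord0 ord_max * M ord_max ord0.
Proof.
have lift0 : lift ord0 0 = ord_max :> 'I_2 by apply: val_inj.
have lift1 : lift ord_max 0 = ord0 :> 'I_2 by apply: val_inj.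
rewrite (expand_det_row _ ord0) sum_ord2 /cofactor !det_mx11 !mxE lift0 lift1.
by rewrite expr0 expr1 mul1r mulN1r mulrN.
Qed.

Lemma euler_homog2 (R : comNzRingType) (d : nat) (p : {mpoly R[2]}) :
  p \is d.-homog ->
  varx R * p^`M(ord0) + vary R * p^`M(ord_max) = d%:R *: p.
Proof. by move=> hp; rewrite -(euler_homog hp) sum_ord2. Qed.

Lemma jacobian_det2 (R : numDomainType) (f : polymap R 2) :
  let p := tnth f ord0 in let q := tnth f ord_max in
  (forall X, \det (jacobian_mx f X) = 1) ->
  p^`M(ord0) * q^`M(ord_max) - p^`M(ord_max) * q^`M(ord0) = 1.
Proof.
move=> p q det1; apply/eqP; rewrite -subr_eq0; apply/eqP.
apply: mpoly_meval_eq0 => v; pose X : 'cV[R]_2 := \col_i v i.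
have eqv : (fun k => X k 0) =1 v by move=> k; rewrite mxE.
move: (det1 X); rewrite det_ord2 !mxE !(meval_eq _ eqv).
by rewrite !mevalB !mevalM meval1 => ->; rewrite subrr.
Qed.

(** The signs make (a, b) span the kernel of the form; x + y is the case
    (a, b) = (-1, 1). *)
Definition linear_form (R : comNzRingType) (a b : R) : {mpoly R[2]} :=
  b *: varx R - a *: vary R.

Lemma mderiv_linear_form (R : comNzRingType) (a b : R) :
  (linear_form a b)^`M(ord0) = b%:MP /\
  (linear_form a b)^`M(ord_max) = (- a)%:MP.
Proof.
rewrite /linear_form !mderivB !mderivZ !mderivXU /= !scaler0 subr0 sub0r.
by rewrite -[b%:MP]mulr1 -[(- a)%:MP]mulr1 !mul_mpolyC scaleNr.
Qed.

Lemma linear_form_eq0 (R : comNzRingType) (a b : R) :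
  linear_form a b = 0 -> (a == 0) && (b == 0).
Proof.
move=> L0; have [] := mderiv_linear_form a b.
rewrite L0 !raddf0 => /esym/eqP + /esym/eqP.
by rewrite !mpolyC_eq0 oppr_eq0 => -> ->.
Qed.

Lemma linear_form_meval (R : comNzRingType) (a b : R) (v : 'I_2 -> R) :
  (linear_form a b).@[v] = b * v ord0 - a * v ord_max.
Proof. by rewrite mevalB !mevalZ !mevalXU. Qed.

Lemma sum_xy_meval (R : comNzRingType) (v : 'I_2 -> R) :
  (varx R + vary R).@[v] = v ord0 + v ord_max.
Proof. by rewrite mevalD !mevalXU. Qed.

Lemma dhomog_sum_xy (R : comNzRingType) (k : nat) :
  (varx R + vary R) ^+ k \is k.-homog.
Proof.
rewrite -[X in X.-homog]mul1n dhomogMn // rpredD // dhomogX /=; exact/eqP/mdeg1.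
Qed.

Lemma sum_sqr_neq0 (R : realDomainType) (a b : R) :
  (a != 0) || (b != 0) -> a ^+ 2 + b ^+ 2 != 0.
Proof. by rewrite paddr_eq0 ?sqr_ge0 // !sqrf_eq0 negb_and. Qed.

(** * Homogeneous maps of the plane with nilpotent Jacobian matrix *)

(** The hypothesis is that V / w has zero x-derivative.  Two homogeneous
    polynomials of the same degree with this property share their leading
    monomial, since x d/dx multiplies a leading coefficient by the x-exponent
    and, the degree being given, this exponent determines a monomial in two
    variables.  Cancelling the leading coefficient must therefore give zero. *)
Lemma homog_proportional (R : numDomainType) (d : nat) (V w : {mpoly R[2]}) :
  V \is d.-homog -> w \is d.-homog ->
  V * w^`M(ord0) = w * V^`M(ord0) ->
  exists a b : R, [/\ (a != 0) || (b != 0) & a *: V = b *: w].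
Proof.
move=> hV hw eqVw.
have [->|w0] := eqVneq w 0.
  by exists 0, 1; rewrite oner_eq0 orbT scale0r scaler0.
have wN0 : w@_(mlead w) != 0 by rewrite mleadc_eq0.
exists w@_(mlead w), V@_(mlead w); rewrite wN0; split=> //.
(* U is V, up to a factor, with its coefficient at the leading monomial of w
   removed; the hypothesis survives this elimination. *)
pose U := w@_(mlead w) *: V - V@_(mlead w) *: w.
suff /eqP : U = 0 by rewrite subr_eq0 => /eqP.
have hU : U \is d.-homog by rewrite rpredB // rpredZ.
have UN0 : U@_(mlead w) = 0.
  by rewrite mcoeffB !mcoeffZ mulrC subrr.
have eqU : U * ('X_ord0 * w^`M(ord0)) = w * ('X_ord0 * U^`M(ord0)).
  rewrite /U mderivB !mderivZ -!mul_mpolyC.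
  transitivity ('X_ord0 * ((w@_(mlead w))%:MP * (V * w^`M(ord0))
     - (V@_(mlead w))%:MP * (w * w^`M(ord0)))); first by ring.
  by rewrite eqVw; ring.
apply/eqP/negPn/negP => U0.
have UN1 : U@_(mlead U) != 0 by rewrite mleadc_eq0.
have lead_theta (p : {mpoly R[2]}) : (mlead ('X_ord0 * p^`M(ord0)) <= mlead p)%O.
  rewrite leNgt; apply/negP => lt; have [p0|p1] := eqVneq ('X_ord0 * p^`M(ord0)) 0.
    by move: lt; rewrite p0 mlead0 ltNge le0x.
  move: p1; rewrite -mleadc_eq0 mcoeff_XMderiv (mcoeff_gt_mlead lt) mulr0.
  by rewrite eqxx.
(* At the product of the leading monomials, eqU equates their x-exponents. *)
have := congr1 (mcoeff (mlead U + mlead w)) eqU.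
rewrite (mleadcMW (lexx _) (lead_theta w)) [(mlead U + _)%MM]addmC.
rewrite (mleadcMW (lexx _) (lead_theta U)).
rewrite !mcoeff_XMderiv => /eqP.
have -> : U@_(mlead U) * ((mlead w ord0)%:R * w@_(mlead w))
  = (U@_(mlead U) * w@_(mlead w)) * (mlead w ord0)%:R by ring.
have -> : w@_(mlead w) * ((mlead U ord0)%:R * U@_(mlead U))
  = (U@_(mlead U) * w@_(mlead w)) * (mlead U ord0)%:R by ring.
have UwN0 : U@_(mlead U) * w@_(mlead w) != 0 by rewrite mulf_neq0.
rewrite (inj_eq (mulfI UwN0)) eqr_nat => /eqP eq0.
have degU : mdeg (mlead U) = d := dhomog_mf hU (mlead_supp U0).
have degw : mdeg (mlead w) = d := dhomog_mf hw (mlead_supp w0).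
have eqm : mlead w = mlead U.
  move/eqP: degU; rewrite -degw !mdegE !big_ord_recl !big_ord0 eq0 !addn0.
  rewrite eqn_add2l => /eqP eq1; apply/mnmP => i.
  case: (unliftP ord0 i) => [j|] ->; last exact: eq0.
  by rewrite [j]ord1 eq1.
by move: UN1; rewrite -eqm UN0 eqxx.
Qed.

(** The derivative U of V in the orthogonal direction (b, -a) is again constant
    along (a, b), and Euler's identity in the orthogonal frame reduces to
    (a^2 + b^2) (deg V) V = L U; so each degree contributes one factor L. *)
Lemma homog_constant_along (R : realFieldType) (a b : R) (d : nat)
    (V : {mpoly R[2]}) :
  (a != 0) || (b != 0) -> V \is d.-homog ->
  a *: V^`M(ord0) + b *: V^`M(ord_max) = 0 ->
  exists e : R, V = e *: linear_form a b ^+ d.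
Proof.
move=> /sum_sqr_neq0 ab0; elim: d V => [|d IHd] V hV dV0.
  by exists V@_0%MM; rewrite expr0 alg_mpolyC; apply: dhomog0_const.
pose U := b *: V^`M(ord0) - a *: V^`M(ord_max).
have [||e Ue] := IHd U.
- by rewrite rpredB // rpredZ // dhomog_mderiv.
- have d0 := congr1 (mderiv ord0) dV0; have d1 := congr1 (mderiv ord_max) dV0.
  rewrite /U !mderivB !mderivZ (mderiv_comm ord_max ord0).
  move: d0 d1; rewrite !mderivD !mderivZ !raddf0 (mderiv_comm ord_max ord0).
  rewrite -!mul_mpolyC => d0 d1.
  have -> : forall A B r s t : {mpoly R[2]},
      A * (B * r - A * s) + B * (B * s - A * t)
    = B * (A * r + B * s) - A * (A * s + B * t).
    by move=> *; ring.
  by rewrite d0 d1 !mulr0 subrr.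
have N0 : (a ^+ 2 + b ^+ 2) * d.+1%:R != 0 by rewrite mulf_neq0 // pnatr_eq0.
(* (a^2 + b^2)(x V_x + y V_y) =
     L (b V_x - a V_y) + (a x + b y)(a V_x + b V_y). *)
exists (((a ^+ 2 + b ^+ 2) * d.+1%:R)^-1 * e).
apply: (scalerI N0); rewrite scalerA mulVKf // [linear_form a b ^+ _]exprS scalerAr -Ue.
rewrite -scalerA -(euler_homog2 hV) /linear_form /U -!mul_mpolyC.
move: dV0; rewrite -!mul_mpolyC => dV0; rewrite mpolyCD !rmorphXn /=.
rewrite -[RHS]addr0 -[in RHS](mulr0 (a%:MP * varx R + b%:MP * vary R)) -dV0.
by ring.
Qed.

(** The hypotheses are the vanishing of the trace and of the determinant of the
    Jacobian matrix of (W, w). *)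
Lemma nilpotent_homog_normal_form (R : realFieldType) (d : nat)
    (W w : {mpoly R[2]}) :
  W \is d.+1.-homog -> w \is d.+1.-homog ->
  W^`M(ord0) + w^`M(ord_max) = 0 ->
  W^`M(ord0) * w^`M(ord_max) - W^`M(ord_max) * w^`M(ord0) = 0 ->
  exists a b e : R, [/\ (a != 0) || (b != 0),
    W = (a * e) *: linear_form a b ^+ d.+1 &
    w = (b * e) *: linear_form a b ^+ d.+1].
Proof.
move=> hW hw div0 jac0.
have wronsk : W * w^`M(ord0) = w * W^`M(ord0).
  have d0 : (d.+1%:R : R) != 0 by rewrite pnatr_eq0.
  apply: (scalerI d0); rewrite !scalerAl -(euler_homog2 hW) -(euler_homog2 hw).
  apply/eqP; rewrite -subr_eq0; apply/eqP.
  transitivity (- vary R *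
    (W^`M(ord0) * w^`M(ord_max) - W^`M(ord_max) * w^`M(ord0))).
    by ring.
  by rewrite jac0 mulr0.
have [b [a [ba0 bWaw]]] := homog_proportional hW hw wronsk.
have ab0 : (a != 0) || (b != 0) by rewrite orbC.
have N0 := sum_sqr_neq0 ab0.
(* (W, w) is a multiple of (a, b); V is its coordinate by orthogonal projection. *)
pose V := (a ^+ 2 + b ^+ 2)^-1 *: (a *: W + b *: w).
have WV : W = a *: V.
  rewrite /V scalerA mulrC -scalerA scalerDr [a *: (a *: W)]scalerA.
  rewrite [a *: (b *: w)]scalerA.
  rewrite [a * b]mulrC -[(b * a) *: w]scalerA -bWaw scalerA -scalerDl -!expr2.
  by rewrite scalerA mulVf // scale1r.
have wV : w = b *: V.
  rewrite /V scalerA mulrC -scalerA scalerDr [b *: (a *: W)]scalerA.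
  rewrite [b * a]mulrC -[(a * b) *: W]scalerA bWaw [a *: (a *: w)]scalerA.
  by rewrite [b *: (b *: w)]scalerA -scalerDl -!expr2 scalerA mulVf // scale1r.
have hV : V \is d.+1.-homog by rewrite rpredZ // rpredD // rpredZ.
have [|e Ve] := homog_constant_along ab0 hV.
  by rewrite -!mderivZ -WV -wV.
by exists a, b, e; rewrite -!scalerA -Ve.
Qed.

(** * Separating degrees in the Jacobian determinant *)

Lemma degree_split (R : idomainType) (m : nat) (c : nat -> R)
    (D T J : {mpoly R[2]}) :
  let q := \sum_(2 <= k < m.+1) c k *: (varx R + vary R) ^+ k.-1 in
  (1 <= m)%N -> D \is m.-homog -> T \is m.-homog -> J \is (m + m).-homog ->
  D + q * T + J = 0 -> [/\ D = 0, J = 0 & q * T = 0].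
Proof.
move=> q m_gt0 hD hT hJ eq0.
have pi_qT d : (d <= m)%N || (m + m <= d)%N -> pihomog mdeg d (q * T) = 0.
  move=> d_far; rewrite /q mulr_suml linear_sum /= big_nat big1 // => k /andP[k2 km].
  rewrite -scalerAl linearZ /= (@pihomog_ne0 _ _ _ (k.-1 + m)) ?scaler0 //.
    by apply/eqP; move: d_far; lia.
  by apply: dhomogM => //; apply: dhomog_sum_xy.
have D0 : D = 0.
  have := congr1 (pihomog mdeg m) eq0; rewrite !pihomogD pi_qT ?leqnn //.
  rewrite (pihomog_dE hD) (pihomog_ne0 _ hJ) ?pihomog0 ?addr0 //.
  by apply/eqP; lia.
have J0 : J = 0.
  have := congr1 (pihomog mdeg (m + m)) eq0; rewrite D0 !pihomogD pi_qT.
    by rewrite (pihomog_dE hJ) pihomog0 !add0r.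
  by rewrite leqnn orbT.
by split=> //; move: eq0; rewrite D0 J0 add0r addr0.
Qed.

Lemma mderiv_sum_xy (R : comNzRingType) (i : 'I_2) :
  (varx R + vary R)^`M(i) = 1.
Proof.
rewrite mderivD !mderivXU; move: i.
by apply: forall_ord2; rewrite /= ?addr0 ?add0r.
Qed.

Lemma mderiv_alpha_sum (R : comNzRingType) (m : nat) (alpha : nat -> R) (g : R)
    (i : 'I_2) :
  (g *: alpha_sum m alpha)^`M(i) =
    \sum_(2 <= k < m.+1) (g * alpha k * k%:R) *: (varx R + vary R) ^+ k.-1.
Proof.
rewrite /alpha_sum scaler_sumr linear_sum /=.
apply: eq_big_nat => k /andP[k2 _]; case: k k2 => // k _.
rewrite !mderivZ mderivXn mderiv_sum_xy mulr1.
by rewrite -scaler_nat !scalerA.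
Qed.

(** The sum has no constant term. *)
Lemma alpha_sum_eq0 (R : numDomainType) (m : nat) (alpha : nat -> R) (g : R) :
  (forall i, (g *: alpha_sum m alpha)^`M(i) = 0) -> g *: alpha_sum m alpha = 0.
Proof.
move=> /mderiv_eq0_const ->; rewrite mcoeffZ linear_sum /= big_nat big1.
  by rewrite mulr0 mpolyC0.
move=> k /andP[k2 _]; rewrite mcoeffZ.
rewrite (dhomog_nemf_coeff (dhomog_sum_xy R k)) ?mulr0 //=.
by rewrite mdeg0; apply/eqP; lia.
Qed.

(** For (W, w) = e L^(d+1) (a, b), the expression assumed to vanish equals
    - (d + 1) e (a + b)^2 L^d. *)
Lemma skew_sum_eq0_normal_form (R : numDomainType) (d : nat) (a b e : R)
    (W w : {mpoly R[2]}) :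
  W = (a * e) *: linear_form a b ^+ d.+1 ->
  w = (b * e) *: linear_form a b ^+ d.+1 ->
  w^`M(ord_max) - W^`M(ord0) - w^`M(ord0) + W^`M(ord_max) = 0 ->
  exists c : R, W = c *: (varx R + vary R) ^+ d.+1 /\
                w = - (c *: (varx R + vary R) ^+ d.+1).
Proof.
move=> WE wE T0; have [Lx Ly] := mderiv_linear_form a b.
have : (- (e * (a + b) ^+ 2) * d.+1%:R) *: linear_form a b ^+ d = 0.
  rewrite -T0 WE wE !mderivZ !mderivXn Lx Ly.
  rewrite ![_ * _%:MP]mulrC !mul_mpolyC -!scaler_nat !scalerA.
  rewrite -!scalerBl -scalerDl; congr (_ *: _).
  by move: d.+1%:R => N; ring.
move/eqP; rewrite -mul_mpolyC mulf_eq0 mpolyC_eq0 mulf_eq0 pnatr_eq0.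
rewrite orbF oppr_eq0 mulf_eq0 !expf_eq0 /=.
case/orP => [/orP[/eqP e0|]|/andP[_ /eqP/linear_form_eq0/andP[/eqP a0 /eqP b0]]].
- exists 0; rewrite WE wE; move: (_ ^+ _) (_ ^+ _) => L S.
  by rewrite e0 !mulr0 !scale0r oppr0.
- rewrite addr_eq0 => /eqP ab; exists (a * e * (- a) ^+ d.+1).
  have LE : linear_form a b = (- a) *: (varx R + vary R).
    rewrite /linear_form; have -> : b = - a by rewrite ab opprK.
    by rewrite scalerDr !scaleNr.
  rewrite WE wE LE exprZn !scalerA -scaleNr.
  move: (_ ^+ d.+1) (_ ^+ d.+1) => r S; split; first by [].
  by congr (_ *: _); rewrite ab; ring.
- exists 0; rewrite WE wE; move: (_ ^+ _) (_ ^+ _) => L S.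
  by rewrite a0 b0 !mul0r !scale0r oppr0.
Qed.

(** * Shears *)

Section Shears.
Variables (R : comNzRingType) (n : nat).

Definition shear (v : 'cV[R]_n) (psi : {mpoly R[n]}) : polymap R n :=
  [tuple 'X_i + v i 0 *: psi | i < n].

Lemma polymap_eval_shear v psi X :
  polymap_eval (shear v psi) X = X + psi.@[fun j => X j 0] *: v.
Proof.
apply/colP => i; rewrite !mxE tnth_mktuple mevalD mevalXU mevalZ.
by rewrite [v i 0 * _]mulrC.
Qed.

(** Moving X along v does not change psi, so X - psi(X) v undoes X + psi(X) v. *)
Lemma shear_invertible v (psi : {mpoly R[n]}) :
  (forall (X : 'cV[R]_n) t,
     psi.@[fun j => (X + t *: v) j 0] = psi.@[fun j => X j 0]) ->
  polymap_invertible (shear v psi).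
Proof.
move=> psi_inv; exists (shear v (- psi)); split=> X;
  rewrite !polymap_eval_shear mevalN psi_inv.
  by rewrite scaleNr addrK.
by rewrite scaleNr subrK.
Qed.

End Shears.

Definition plane_vec (R : comNzRingType) (a b : R) : 'cV[R]_2 :=
  \col_i (if i == ord0 then a else b).

Lemma plane_shearE (R : comNzRingType) (a b : R) (psi : {mpoly R[2]}) :
  shear (plane_vec a b) psi = [tuple varx R + a *: psi; vary R + b *: psi].
Proof.
by apply: eq_from_tnth; apply: forall_ord2; rewrite tnth_mktuple mxE.
Qed.

Lemma alpha_sum_meval (R : comNzRingType) (m : nat) (alpha : nat -> R)
    (v : 'I_2 -> R) :
  (alpha_sum m alpha).@[v] =
    \sum_(2 <= k < m.+1) alpha k * (v ord0 + v ord_max) ^+ k.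
Proof.
rewrite raddf_sum /=; apply: eq_bigr => k _.
by rewrite mevalZ rmorphXn /= sum_xy_meval.
Qed.

(** The rows of this matrix add up to (b, -a), so that x + y becomes
    b x - a y; the first row is chosen to make the determinant a^2 + b^2. *)
Definition straightening_mx (R : comNzRingType) (a b : R) : 'M[R]_2 :=
  \matrix_(i, j) (if i == ord0 then if j == ord0 then - a else - b
                  else if j == ord0 then b + a else b - a).

Lemma det_straightening_mx (R : comNzRingType) (a b : R) :
  \det (straightening_mx a b) = a ^+ 2 + b ^+ 2.
Proof. by rewrite det_ord2 !mxE /=; ring. Qed.

Lemma straightening_mx_vec (R : comNzRingType) (a b : R) :
  straightening_mx a b *m plane_vec a b =
    - (a ^+ 2 + b ^+ 2) *: plane_vec 1 (- 1).
Proof.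
by apply/colP; apply: forall_ord2; rewrite !mxE sum_ord2 !mxE /=; ring.
Qed.

Lemma straightening_mx_sum (R : comNzRingType) (a b : R) (X : 'cV[R]_2) :
  (varx R + vary R).@[fun j => (straightening_mx a b *m X) j 0] =
    (linear_form a b).@[fun j => X j 0].
Proof.
by rewrite sum_xy_meval linear_form_meval !mxE !sum_ord2 !mxE /=; ring.
Qed.

Lemma straightening_mx_shear (R : comNzRingType) (a b e : R) (n : nat)
    (X : 'cV[R]_2) :
  let A := straightening_mx a b in
  A *m polymap_eval (shear (plane_vec a b) (e *: linear_form a b ^+ n)) X =
    polymap_eval (shear (plane_vec 1 (- 1))
      ((- e * (a ^+ 2 + b ^+ 2)) *: (varx R + vary R) ^+ n)) (A *m X).
Proof.
move=> A.
rewrite [in LHS]polymap_eval_shear [in RHS]polymap_eval_shear.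
rewrite mulmxDr -scalemxAr straightening_mx_vec scalerA.
congr (_ + _ *: _); rewrite !mevalZ !rmorphXn /= straightening_mx_sum.
by move: (_ ^+ n) => r; ring.
Qed.

(** * Classification of the maps with Jacobian determinant one *)

Theorem theorem2 (R : realType) (m : nat) (alpha : nat -> R)
    (gamma1 gamma2 : R) (W w : {mpoly R[2]}) :
  (1 <= m)%N ->
  gamma1 + gamma2 = 0 ->
  W \is m.+1.-homog ->
  w \is m.+1.-homog ->
  let u := u_map m alpha gamma1 gamma2 in
  let f : polymap R 2 := [tuple tnth u ord0 + W; tnth u ord_max + w] in
  (forall X : 'cV[R]_2, \det (jacobian_mx f X) = 1) ->
  (exists (A : 'M[R]_2) (alpha_m1 : R),
     A \in unitmx /\
     let h : {mpoly R[2]} := alpha_m1 *: (varx R + vary R) ^+ m.+1 in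
     let F : polymap R 2 := [tuple tnth u ord0 + h; tnth u ord_max - h] in
     forall X : 'cV[R]_2,
       polymap_eval f X = invmx A *m polymap_eval F (A *m X)) /\
  polymap_invertible f.
Proof.
move=> m_gt0 gamma12 hW hw u f /jacobian_det2.
have gamma2E : gamma2 = - gamma1 by apply/eqP; rewrite -addr_eq0 addrC gamma12.
set h : {mpoly R[2]} := gamma1 *: alpha_sum m alpha.
have uE (k : {mpoly R[2]}) : [tuple tnth u ord0 + k; tnth u ord_max - k]
    = shear (plane_vec 1 (- 1)) (h + k).
  rewrite plane_shearE scale1r scaleN1r opprD !addrA.
  by rewrite /u gamma2E (tnth_nth 0) [tnth _ ord_max](tnth_nth 0) /= scaleNr.
have f0 : tnth f ord0 = varx R + h + W by [].
have f1 : tnth f ord_max = vary R - h + w.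
  by rewrite /f /u gamma2E !(tnth_nth 0) /= scaleNr.
set q : {mpoly R[2]} := \sum_(2 <= k < m.+1)
  (gamma1 * alpha k * k%:R) *: (varx R + vary R) ^+ k.-1.
have dh i : h^`M(i) = q by exact: mderiv_alpha_sum.
rewrite f0 f1 !mderivD !mderivN !dh !mderivXU /= => jac1.
pose D := W^`M(ord0) + w^`M(ord_max).
pose T := w^`M(ord_max) - W^`M(ord0) - w^`M(ord0) + W^`M(ord_max).
pose J := W^`M(ord0) * w^`M(ord_max) - W^`M(ord_max) * w^`M(ord0).
have hd i : W^`M(i) \is m.-homog /\ w^`M(i) \is m.-homog.
  by split; apply: dhomog_mderiv.
have [hW0 hw0] := hd ord0; have [hW1 hw1] := hd ord_max.
have [] : [/\ D = 0, J = 0 & q * T = 0].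
  apply: (degree_split m_gt0); rewrite -/q.
  - by rewrite rpredD.
  - by rewrite !(rpredD, rpredN).
  - by apply: rpredB; apply: dhomogM.
  apply: (addIr 1); rewrite add0r -[RHS]jac1 /D /T /J.
  move: W^`M(ord0) W^`M(ord_max) w^`M(ord0) w^`M(ord_max) => *.
  by ring.
move=> D0 J0 /eqP qT0.
have [a [b [e [ab WE wE]]]] := nilpotent_homog_normal_form hW hw D0 J0.
move: qT0; rewrite mulf_eq0 => /orP[/eqP q0|/eqP T0].
- have h0 : h = 0 by apply: alpha_sum_eq0 => i; rewrite dh.
  have fE : f = shear (plane_vec a b) (e *: linear_form a b ^+ m.+1).
    rewrite plane_shearE !scalerA -WE -wE.
    apply: eq_from_tnth; apply: forall_ord2; rewrite ?f0 ?f1 h0 ?addr0 ?subr0;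
      by rewrite (tnth_nth 0).
  split; last first.
    rewrite fE; apply: shear_invertible => X t.
    rewrite !mevalZ !rmorphXn /= !linear_form_meval !mxE /=.
    by congr (_ * _ ^+ _); ring.
  have uA : straightening_mx a b \in unitmx.
    by rewrite unitmxE det_straightening_mx unitfE sum_sqr_neq0.
  exists (straightening_mx a b), (- e * (a ^+ 2 + b ^+ 2)); split=> [//|X].
  rewrite -[LHS](mulKmx uA); congr (_ *m _).
  by rewrite fE straightening_mx_shear uE h0 add0r.
- have [c [Wc wc]] := skew_sum_eq0_normal_form WE wE T0.
  split.
    exists 1%:M, c; split=> [|X]; first exact: unitmx1.
    by rewrite invmx1 !mul1mx /f Wc wc.
  have -> : f = shear (plane_vec 1 (- 1)) (h + W) by rewrite -uE /f wc Wc.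
  apply: shear_invertible => X t; rewrite Wc !mevalD !mevalZ !alpha_sum_meval.
  rewrite !rmorphXn /= !sum_xy_meval !mxE /=.
  have -> : X ord0 0 + t * 1 + (X ord_max 0 + t * -1) = X ord0 0 + X ord_max 0.
    by ring.
  by [].
Qed.
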